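(* Let $n,d\geq 2$ be integers and assume that there exist integers $d_1,d_2\geq 1$ with $d=d_1+d_2$ such that $2(d_1+1)=(d_2+1)(n+1)$. Then the Segre-Veronese variety $SV^{(1,1,n)}_{(1,d,1)}$ is $(2d_1+1)$-defective.
   Context: All varieties are over $\mathbb{C}$. $SV^{(n_1,\dots,n_r)}_{(d_1,\dots,d_r)}\subseteq\mathbb{P}^N$, with $N=\prod_{i=1}^r\binom{n_i+d_i}{d_i}-1$, is the image of $\mathbb{P}^{n_1}\times\dots\times\mathbb{P}^{n_r}$ under the embedding induced by the complete linear system $|\mathcal{O}_{\mathbb{P}^{n_1}\times\dots\times\mathbb{P}^{n_r}}(d_1,\dots,d_r)|$. For an irreducible non-degenerate $n$-dimensional variety $X\subseteq\mathbb{P}^N$ and $h\geq 1$, the $h$-secant variety $\mathrm{Sec}_h(X)$ is the Zariski closure of the union of all linear spaces spanned by collections of $h$ points of $X$; its expected dimension is $\min\{nh+h-1,N\}$. $X$ is $h$-defective if $\dim \mathrm{Sec}_h(X)$ is strictly smaller than the expected dimension. *)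

(* Defs.v *)
(* mpoly has to be imported before classical and topology: in the other order
   their notations clash. *)
From HB Require Import structures.
From mathcomp Require Import all_boot all_order all_algebra.
From mathcomp Require Import mpoly.
From mathcomp Require Import all_classical reals ereal topology.

Set Implicit Arguments.
Unset Strict Implicit.
Unset Printing Implicit Defensive.

Import Order.TTheory GRing.Theory Num.Theory.

Local Open Scope classical_set_scope.
Local Open Scope ring_scope.

Definition irreducible_set (T : topologicalType) (A : set T) : Prop :=
  A !=set0 /\
  forall B C : set T, closed B -> closed C ->
    A `<=` B `|` C -> A `<=` B \/ A `<=` C.

(* Z 0 `<` ... `<` Z k is a chain of irreducible closed subsets of A, where A
   carries the subspace topology. *)
Definition irreducible_chain (T : topologicalType) (A : set T) (k : nat)
    (Z : nat -> set T) : Prop :=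
  [/\ forall i, (i <= k)%N -> irreducible_set (Z i),
      forall i, (i <= k)%N -> exists2 B, closed B & Z i = A `&` B &
      forall i, (i < k)%N -> Z i `<` Z i.+1].

(* Krull dimension of A in the subspace topology; it is -oo when A is empty. *)
Definition krull_dim (R : realType) (T : topologicalType) (A : set T) : \bar R :=
  ereal_sup [set (k%:R : R)%:E | k in [set k | exists Z, irreducible_chain A k Z]].

(* The projective space P^N, as the lines of F^(N+1). *)
Record proj (F : fieldType) (N : nat) := Proj {
  line : {vspace 'rV[F]_N.+1};
  dim_line : \dim line == 1 }.

HB.instance Definition _ F N := [isSub for @line F N].
HB.instance Definition _ F N := [Choice of proj F N by <:].

Section Zariski.
Variables (F : fieldType) (N : nat).
Implicit Types (p q : {mpoly F[N.+1]}) (L : proj F N).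

Definition vanishes p L : Prop :=
  forall v, v \in line L -> p.@[v ord0] = 0.

Definition zero_locus (S : set {mpoly F[N.+1]}) : set (proj F N) :=
  [set L | forall p, S p -> vanishes p L].

Definition zariski_closed (A : set (proj F N)) : Prop :=
  exists2 S : set {mpoly F[N.+1]},
    (forall p, S p -> p \is homog mdeg) & A = zero_locus S.

Definition zariski_open (A : set (proj F N)) : Prop := zariski_closed (~` A).

Lemma line_generator L : exists2 u, u != 0 & line L = <[u]>%VS.
Proof.
exists (vpick (line L)).
  by rewrite vpick0 -dimv_eq0 (eqP (dim_line L)).
apply/esym/eqP; rewrite eqEdim -memvE memv_pick /=.
by rewrite (eqP (dim_line L)) dim_vline vpick0 -dimv_eq0 (eqP (dim_line L)).
Qed.

Lemma meval_homogZ d p (a : F) (u : 'rV[F]_N.+1) :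
  p \is d.-homog -> p.@[(a *: u) ord0] = a ^+ d * p.@[u ord0].
Proof.
move=> /dhomogP hp; rewrite !mevalE mulr_sumr big_seq [RHS]big_seq.
apply: eq_bigr => m /hp dm.
under eq_bigr do rewrite mxE exprMn.
by rewrite big_split /= prodrXr -mdegE dm mulrCA.
Qed.

Lemma vanishes_generator p L u : p \is homog mdeg -> line L = <[u]>%VS ->
  vanishes p L <-> p.@[u ord0] = 0.
Proof.
move=> /homogP[d hp] Lu; split=> [|pu v]; first by apply; rewrite Lu memv_line.
by rewrite Lu => /vlineP[a ->]; rewrite (meval_homogZ _ _ hp) pu mulr0.
Qed.

Lemma zariski_openT : zariski_open setT.
Proof.
exists [set 1] => [p ->|].
  by apply/homogP; exists 0%N; apply: dhomog1.
rewrite setCT; apply/esym; rewrite -subset0 => L /(_ 1 erefl) /(_ 0 (mem0v _)).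
by rewrite meval1 => /eqP; rewrite oner_eq0.
Qed.

Lemma zariski_openI : setI_closed zariski_open.
Proof.
move=> A B [S hS eA] [S' hS' eB]; rewrite /zariski_open setCI eA eB.
exists [set pq | exists p q, [/\ S p, S' q & pq = p * q]].
  move=> _ [p [q [/hS/homogP[d hp] /hS'/homogP[e hq] ->]]].
  by apply/homogP; exists (d + e)%N; apply: dhomogM.
apply/seteqP; split=> [L LAB _ [p [q [Sp Sq ->]]] v Lv|L LAB].
  rewrite mevalM; case: LAB => [/(_ _ Sp _ Lv)|/(_ _ Sq _ Lv)] ->.
    by rewrite mul0r.
  by rewrite mulr0.
have [u _ Lu] := line_generator L.
apply: contrapT => /not_orP[/existsNP[p /not_implyP[Sp pL]]].
move=> /existsNP[q /not_implyP[Sq qL]].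
have /(_ u) := LAB (p * q) (ex_intro _ p (ex_intro _ q (And3 Sp Sq erefl))).
rewrite Lu memv_line mevalM => /(_ isT) /eqP; rewrite mulf_eq0.
by case/orP=> /eqP; rewrite -(vanishes_generator _ Lu); do ?[exact: hS|exact: hS'].
Qed.

Lemma zariski_open_bigU (I : Type) (f : I -> set (proj F N)) :
  (forall i, zariski_open (f i)) -> zariski_open (\bigcup_i f i).
Proof.
move=> fo; rewrite /zariski_open setC_bigcup.
exists [set p | exists2 i, p \is homog mdeg &
                  forall L, (~` f i) L -> vanishes p L].
  by move=> p [].
apply/seteqP; split=> [L Lf p [i _]|L Lf i _]; first by apply; apply: Lf.
have [S hS eS] := fo i; rewrite eS => p Sp.
apply: Lf; exists i; first exact: hS.
by move=> L'; rewrite eS; apply.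
Qed.

HB.instance Definition _ := isOpenTopological.Build (proj F N)
  zariski_openT zariski_openI zariski_open_bigU.

Lemma closed_zariskiE (A : set (proj F N)) : closed A = zariski_closed A.
Proof.
by rewrite -openC /open /= /zariski_open setCK.
Qed.

(* The union of the linear spaces spanned by h points of X, not assumed
   distinct, and its Zariski closure. *)
Definition secant_union (h : nat) (X : set (proj F N)) : set (proj F N) :=
  [set L | exists2 P : 'I_h -> proj F N, forall i, X (P i) &
             (line L <= \sum_i line (P i))%VS].

Definition secant_variety (h : nat) (X : set (proj F N)) : set (proj F N) :=
  closure (secant_union h X).

End Zariski.

Definition expected_dim (R : realType) (n : \bar R) (h N : nat) : \bar R :=
  mine (n * (h%:R)%:E + (h%:R - 1)%:E)%E (N%:R)%:E.

(* Meant for X irreducible and non-degenerate, and 1 <= h. *)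
Definition defective (R : realType) (F : fieldType) (N : nat)
    (X : set (proj F N)) (h : nat) : Prop :=
  (krull_dim R (secant_variety h X) < expected_dim (krull_dim R X) h N)%E.

(* Exponents of the monomials of degree d in n + 1 variables. *)
Definition monomial (n d : nat) : finType :=
  {t : n.+1.-tuple 'I_d.+1 | (\sum_(k <- t) k == d)%N}.

Section SegreVeronese.
Variables (F : fieldType) (r : nat) (n d : r.-tuple nat).

Definition sv_index : finType :=
  {dffun forall i : 'I_r, monomial (tnth n i) (tnth d i)}.

Definition sv_dim : nat :=
  (\prod_(i < r) 'C(tnth n i + tnth d i, tnth d i)).-1.

Lemma card_monomial a b : #|monomial a b| = 'C(a + b, b).
Proof.
rewrite card_sig -bin_sub ?leq_addl// addnK -card_ord_partitions.
by apply: eq_card => t; rewrite !inE.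
Qed.

Lemma card_sv_index : #|sv_index| = sv_dim.+1.
Proof.
rewrite prednK; last by rewrite prodn_gt0// => i; rewrite bin_gt0 leq_addl.
rewrite card_dep_ffun foldrE big_image /=.
by apply: eq_bigr => i _; rewrite card_monomial.
Qed.

Definition sv_coord (j : 'I_sv_dim.+1) : sv_index :=
  enum_val (cast_ord (esym card_sv_index) j).

(* The vector of all monomials of multidegree d in the homogeneous coordinates
   x i of P^(n_i), i < r. *)
Definition sv_vec (x : forall i : 'I_r, 'rV[F]_(tnth n i).+1) :
    'rV[F]_sv_dim.+1 :=
  \row_j \prod_(i < r) \prod_(k < (tnth n i).+1)
           x i ord0 k ^+ tnth (val (sv_coord j i)) k.

Lemma sv_vec_neq0 x : (forall i, x i != 0) -> sv_vec x != 0.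
Proof.
move=> x_neq0.
have /fin_all_exists[k xk] i : exists k, x i ord0 k != 0.
  by have /rV0Pn := x_neq0 i.
pose t i : (tnth n i).+1.-tuple 'I_(tnth d i).+1 :=
  [tuple if l == k i then ord_max else ord0 | l < (tnth n i).+1].
have tE i : (\sum_(l <- t i) l == tnth d i)%N.
  rewrite big_tuple; under eq_bigr do rewrite tnth_mktuple.
  by rewrite (bigD1 (k i)) //= eqxx big1 ?addn0 // => l /negPf->.
pose m : sv_index := [ffun i => Sub (t i) (tE i)].
apply/rV0Pn; exists (cast_ord card_sv_index (enum_rank m)).
rewrite mxE prodf_seq_neq0; apply/allP => i _ /=.
rewrite prodf_seq_neq0; apply/allP => l _ /=.
rewrite /sv_coord cast_ordK enum_rankK ffunE /= tnth_mktuple.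
by have [->|_] := eqVneq l (k i); rewrite ?expr0 ?oner_eq0 // expf_neq0.
Qed.

Lemma sv_vecZ x (a : 'I_r -> F) :
  sv_vec (fun i => a i *: x i) = (\prod_i a i ^+ tnth d i) *: sv_vec x.
Proof.
apply/rowP => j; rewrite !mxE -big_split /=; apply: eq_bigr => i _.
under eq_bigr do rewrite mxE exprMn.
rewrite big_split /= prodrXr; congr (_ ^+ _ * _).
by have /eqP := valP (sv_coord j i); rewrite big_tuple.
Qed.

Lemma sv_map_subproof (P : forall i : 'I_r, proj F (tnth n i)) :
  \dim <[sv_vec (fun i => vpick (line (P i)))]>%VS == 1.
Proof.
rewrite dim_vline sv_vec_neq0// => i.
by rewrite vpick0 -dimv_eq0 (eqP (dim_line (P i))).
Qed.

Definition sv_map (P : forall i : 'I_r, proj F (tnth n i)) : proj F sv_dim :=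
  Proj (sv_map_subproof P).

(* Any homogeneous coordinates of the P i compute sv_map P. *)
Lemma sv_mapE P x : (forall i, line (P i) = <[x i]>%VS) ->
  line (sv_map P) = <[sv_vec x]>%VS.
Proof.
move=> Px; pose v i := vpick (line (P i)).
have v_neq0 i : v i != 0 by rewrite vpick0 -dimv_eq0 (eqP (dim_line (P i))).
have /fin_all_exists[a va] i : exists a, v i = a *: x i.
  by apply/vlineP; rewrite -Px memv_pick.
rewrite /= -[X in sv_vec X]/v (_ : v = fun i => a i *: x i).
  rewrite sv_vecZ; apply/eqP; rewrite eqEdim -memvE.
  have c_neq0 : \prod_i a i ^+ tnth d i != 0.
    rewrite prodf_seq_neq0; apply/allP => i _ /=; rewrite expf_neq0 //.
    by have := v_neq0 i; rewrite va; apply: contraNneq => ->; rewrite scale0r.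
  rewrite memvZ ?memv_line //= !dim_vline scaler_eq0 (negPf c_neq0) /=.
  by case: (sv_vec x == 0).
by apply: functional_extensionality_dep => i; exact: va.
Qed.

Definition segre_veronese : set (proj F sv_dim) := range sv_map.

End SegreVeronese.

Arguments segre_veronese F {r} n d.

(* Main.v *)
From mathcomp Require Import all_boot all_order all_algebra.
From mathcomp Require Import mpoly.
From mathcomp Require Import all_classical reals ereal topology.
From mathcomp Require Import complex zify.
Require Import Defs.

(** Put h = 2 d1 + 1 and let X be the Segre-Veronese variety, of dimension
n + 2 in P^N.  The relation between n, d1 and d2 gives h (n + 3) - 1 =
N + (n - 1), so Sec_h(X) is expected to fill P^N.  It does not, because one
of its equations is a determinant.

Write z_(a, k, c) for the coordinate of P^N that takes the value
x_a y_0^(d-k) y_1^k w_c on X.  Splitting the binary forms of degree d as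
d = d1 + d2 arranges the coordinates in a flattening: the matrix with rows
(a, i), i <= d1, columns (c, j), j <= d2, and entries z_(a, i+j, c).  It is
square, of size 2 (d1 + 1) = (d2 + 1) (n + 1) = h + 1.  It has rank at most 1
at the points of X (rank_flattening), hence rank at most h on Sec_h(X), so its
determinant vanishes there (vanishing_secant_det).  That determinant is not
the zero polynomial: its value is 1 or -1 at the point whose coordinate
z_(a, k, c) is 1 when a (d1 + 1) + k = c (d2 + 1) + d2 and 0 otherwise, where
the flattening is the identity matrix, up to the order of its columns
(hankel_det_neq0).

Two facts about the Krull dimension turn this into defectivity.

A closed set Z contained in a hypersurface of P^N has dimension at most N - 1
(krull_dim_in_hypersurface).  The polynomials vanishing on the cones over the
members of a chain of irreducible closed subsets of Z form prime ideals of the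
ring of polynomials in N + 1 variables; the ideal of the origin of the affine
space may be added at one end of this chain of primes, and the zero ideal at
the other end.  So it is enough that a chain of primes in F[x_1, ..., x_n] has length at most n
(prime_chain_leq), and this follows by counting: a chain of length k produces
q^k polynomials that are linearly independent and of degree O(q), whereas the
space of polynomials of degree at most e q has dimension at most (e q + 1)^n.

Conversely X has dimension at least n + 2 (krull_dim_segre_veronese_ge): the
images of products of coordinate subspaces, enlarged by one coordinate at a
time, are irreducible closed subsets of X. *)

Set Implicit Arguments.
Unset Strict Implicit.
Unset Printing Implicit Defensive.

Import Order.TTheory GRing.Theory Num.Theory.

Local Open Scope classical_set_scope.
Local Open Scope ring_scope.

(** * Chains of prime ideals in a polynomial ring *)

Record prime_ideal (A : comNzRingType) (I : set A) : Prop := PrimeIdeal {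
  prime_ideal0 : I 0;
  prime_idealD : forall x y, I x -> I y -> I (x + y);
  prime_idealM : forall a x, I x -> I (a * x);
  prime_ideal1 : ~ I 1;
  prime_idealP : forall x y, I (x * y) -> I x \/ I y }.

Section IndependenceModulo.
Variables (F : fieldType) (A : comAlgType F).
Implicit Types I J : set A.

Definition free_mod I (X : finType) (b : X -> A) : Prop :=
  forall c : X -> F, I (\sum_x c x *: b x) -> forall x, c x = 0.

(** This is how one step of a chain of primes gains one dimension.  In a
relation between the elements f^j * b x modulo I, the terms with j > 0 are in
J, so the coefficients of the terms with j = 0 vanish, by independence of b
modulo J; what is left is a multiple of f, and f can be cancelled because I is
prime. *)
Lemma free_mod_powers I J (f : A) (X : finType) (b : X -> A) q :
  prime_ideal I -> prime_ideal J -> I `<=` J -> J f -> ~ I f ->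
  free_mod J b -> free_mod I (fun jx : 'I_q * X => f ^+ jx.1 * b jx.2).
Proof.
move=> pI pJ IJ Jf nIf bfree.
have Jsum (T : finType) (g : T -> A) : (forall t, J (g t)) -> J (\sum_t g t).
  move=> Jg; apply: (@big_ind _ J) => //.
  - exact: prime_ideal0.
  - exact: prime_idealD.
have free_nat m (c : nat -> X -> F) :
    I (\sum_(j < m) f ^+ j * \sum_x c j x *: b x) ->
    forall j x, (j < m)%N -> c j x = 0.
  elim: m c => [//|m IHm] c Ic.
  have c0 : forall x, c 0%N x = 0.
    apply: bfree; have := IJ _ Ic; rewrite big_ord_recl expr0 mul1r => Jc.
    rewrite -[X in J X](addrK (\sum_(i < m) f ^+ lift ord0 i *
                                 \sum_x c (lift ord0 i) x *: b x)).
    apply: (prime_idealD pJ) => //; rewrite -sumrN; apply: Jsum => i.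
    by rewrite exprS -mulrA mulrC -mulNr; apply: prime_idealM.
  have : I (f * \sum_(j < m) f ^+ j * \sum_x c j.+1 x *: b x).
    move: Ic; rewrite big_ord_recl big1 ?mulr0 ?add0r => [Ic|x _]; last first.
      by rewrite c0 scale0r.
    rewrite mulr_sumr (eq_bigr _ (fun i _ => mulrA _ _ _)).
    by under eq_bigr do rewrite -exprS.
  case/(prime_idealP pI) => // /(IHm (fun j => c j.+1)) cS.
  by move=> [|j] x jm; [exact: c0|exact: cS].
move=> c Ic [j x] /=.
(* extension by zero of the coefficients to all exponents *)
pose c' k y := if insub k is Some k' then c (k', y) else 0.
have c'E (k : 'I_q) y : c' k y = c (k, y) by rewrite /c' valK.
rewrite -c'E; apply: (free_nat q) => //.
rewrite (_ : \sum_(_ < _) _ = \sum_jx c jx *: (f ^+ jx.1 * b jx.2)) //.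
under eq_bigr do rewrite mulr_sumr.
rewrite pair_bigA /=; apply: eq_bigr => -[k y] _ /=.
by rewrite c'E -scalerAr.
Qed.

End IndependenceModulo.

Section PrimeChains.
Variables (F : fieldType) (n : nat).

(** A polynomial of degree at most s is determined by its coefficients at the
(s + 1)^n monomials whose exponents are all at most s. *)
Lemma free_card_leq (X : finType) (b : X -> {mpoly F[n]}) s :
  (forall x, msize (b x) <= s.+1)%N -> free_mod [set 0] b ->
  (#|X| <= s.+1 ^ n)%N.
Proof.
move=> bs bfree; pose Y : finType := {ffun 'I_n -> 'I_s.+1}.
have -> : (s.+1 ^ n = #|Y|)%N by rewrite card_ffun !card_ord.
pose M := \matrix_(i < #|X|, j < #|Y|)
  (b (enum_val i))@_[multinom (enum_val j k : nat) | k < n].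
suff /eqP <- : row_free M by exact: rank_leq_col.
rewrite -kermx_eq0; apply/eqP/row_matrixP => i; apply/rowP => l.
have : (row i (kermx M)) *m M = 0 by apply/sub_kermxP/row_sub.
move: (row i _) => c cM; rewrite row0 mxE.
rewrite -(enum_valK l); apply: (bfree (fun x => c ord0 (enum_rank x))).
apply/mpolyP => m; rewrite mcoeff0 raddf_sum /=.
have [ms|ms] := ltnP (mdeg m) s.+1; last first.
  rewrite big1 // => x _; rewrite mcoeffZ memN_msupp_eq0 ?mulr0 //.
  by apply: msize_mdeg_ge; apply: leq_trans ms.
have mE : m = [multinom ([ffun k => inord (m k)] : Y) k : nat | k < n].
  apply/mnmP => k; rewrite mnmE ffunE inordK // (leq_trans _ ms) // ltnS.
  by rewrite mdegE (bigD1 k) //= leq_addr.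
have := congr1 (fun A : 'rV__ =>
  A ord0 (enum_rank ([ffun k => inord (m k)] : Y))) cM.
rewrite !mxE => cm; rewrite -[RHS]cm.
rewrite (reindex (@enum_val X predT)) /=; last first.
  by apply: onW_bij; apply: enum_val_bij.
apply: eq_bigr => j _; rewrite mcoeffZ !mxE enum_valK enum_rankK; congr (_ * _).
by rewrite {1}mE.
Qed.

Lemma msize_mul_leq (p q : {mpoly F[n]}) a b :
  (msize p <= a.+1)%N -> (msize q <= b.+1)%N -> (msize (p * q) <= (a + b).+1)%N.
Proof.
have [->|p0] := eqVneq p 0; first by rewrite mul0r msize0.
have [->|q0] := eqVneq q 0; first by rewrite mulr0 msize0.
rewrite msizeM //; move: (msize p) (msize q) => u v; lia.
Qed.

Lemma msize_exp_leq (p : {mpoly F[n]}) s j :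
  (msize p <= s.+1)%N -> (msize (p ^+ j) <= (j * s).+1)%N.
Proof.
move=> ps; elim: j => [|j IHj]; first by rewrite expr0 msize1.
by rewrite exprS mulSn; apply: msize_mul_leq.
Qed.

(** Applied along the chain, free_mod_powers yields for every q a family of
q^k polynomials, independent modulo the last prime and of degree at most e q,
where e does not depend on q.  If k > n, a large q contradicts
free_card_leq. *)
Lemma prime_chain_leq (I : nat -> set {mpoly F[n]}) k :
  (forall i, (i <= k)%N -> prime_ideal (I i)) ->
  (forall i, (i < k)%N -> I i.+1 `<` I i) -> (k <= n)%N.
Proof.
move=> Iprime Idec.
have [e free_k] : exists e, forall q, exists X : finType,
    exists b : X -> {mpoly F[n]},
    [/\ free_mod (I k) b, #|X| = (q ^ k)%N &
        forall x, (msize (b x) <= (e * q).+1)%N].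
  elim: k Iprime Idec => [|k IHk] Iprime Idec.
    exists 0%N => q; exists unit, (fun=> 1); split => [c| |x].
    - rewrite (big_pred1 tt) => [|[] //] Ic [].
      apply: contrapT => /eqP c0; apply: (prime_ideal1 (Iprime 0%N isT)).
      have := prime_idealM (Iprime 0%N isT) (c tt)^-1%:MP Ic.
      by rewrite mul_mpolyC scalerA mulVf // scale1r.
    - by rewrite card_unit.
    - by rewrite msize1.
  have [||e free_k] := IHk.
  - by move=> i ik; apply: Iprime; apply: leqW.
  - by move=> i ik; apply: Idec; apply: leqW.
  have [Isub /existsNP[f /not_implyP[Ikf nIf]]] := Idec k (leqnn _).
  exists (msize f + e)%N => q; have [X [b [bfree cardX bs]]] := free_k q.
  exists ('I_q * X)%type, (fun jx : 'I_q * X => f ^+ jx.1 * b jx.2); split.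
  - apply: (@free_mod_powers _ {mpoly F[n]} (I k.+1) (I k)) => //.
      exact: Iprime.
    exact: Iprime (leqnSn k).
  - by rewrite card_prod card_ord cardX expnS.
  move=> [j x] /=; have := msize_exp_leq j (leqnSn (msize f)).
  move=> /msize_mul_leq /(_ (bs x)) /leq_trans; apply.
  by rewrite ltnS mulnDl leq_add2r mulnC leq_mul2l ltnW ?orbT.
rewrite leqNgt; apply/negP => nk.
(* q^(n+1) > (e q + 1)^n holds as soon as q > (e + 1)^n *)
pose q := (e.+1 ^ n).+1; have [X [b [bfree cardX bs]]] := free_k q.
have := @free_card_leq X b _ bs; rewrite cardX => le_card.
have /le_card : free_mod [set 0] b.
  by move=> c c0; apply: bfree; rewrite c0; exact: prime_ideal0 (Iprime k _).
apply/negP; rewrite -ltnNge.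
have eq_ltq : ((e * q).+1 <= e.+1 * q)%N by rewrite mulSn /q; lia.
have le_pow : ((e * q).+1 ^ n <= (e.+1 * q) ^ n)%N.
  by case: (n) => // m; rewrite leq_exp2r.
apply: leq_ltn_trans le_pow _.
rewrite expnMn; apply: leq_trans (_ : q ^ n.+1 <= _)%N; last exact: leq_pexp2l.
by rewrite expnS ltn_pmul2r ?expn_gt0.
Qed.

End PrimeChains.

(** * Dimension of a closed subset of a hypersurface *)

Lemma poly_eq0_everywhere (F : numFieldType) (p : {poly F}) :
  (forall a, p.[a] = 0) -> p = 0.
Proof.
move=> p0; apply/eqP; apply: contraT => p_neq0.
have /(max_poly_roots p_neq0) : all (root p) [seq i%:R | i <- iota 0 (size p)].
  by apply/allP => a _; rewrite /root p0.
rewrite size_map size_iota ltnn map_inj_uniq ?iota_uniq => [/(_ isT)//|i j].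
by move/eqP; rewrite eqr_nat => /eqP.
Qed.

Lemma horner_mmap (A : comNzRingType) n (w : 'I_n -> {poly A})
    (p : {mpoly A[n]}) a :
  (mmap polyC w p).[a] = p.@[fun i => (w i).[a]].
Proof.
rewrite mevalE /mmap horner_sum; apply: eq_bigr => m _.
rewrite hornerM hornerC /mmap1 horner_prod; congr (_ * _).
by apply: eq_bigr => i _; rewrite horner_exp.
Qed.

Section VanishingIdeals.
Variables (F : numFieldType) (N : nat).
Implicit Types (p q : {mpoly F[N.+1]}) (L : proj F N) (Z : set (proj F N)).

(** The restrictions of p and q to a line through the origin are polynomials
in one variable. *)
Lemma vanishesM p q L : vanishes (p * q) L -> vanishes p L \/ vanishes q L.
Proof.
have [u _ Lu] := line_generator L => pq0.
pose w i := 'X * (u ord0 i)%:P : {poly F}.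
have wE r a : (mmap polyC w r).[a] = r.@[(a *: u) ord0].
  rewrite horner_mmap; apply: meval_eq => i.
  by rewrite /w hornerM hornerX hornerC mxE.
have w0 r : mmap polyC w r = 0 -> vanishes r L.
  by move=> r0 v; rewrite Lu => /vlineP[a ->]; rewrite -wE r0 horner0.
have /eqP : mmap polyC w p * mmap polyC w q = 0.
  apply: poly_eq0_everywhere => a; rewrite hornerM !wE -mevalM.
  by apply: pq0; rewrite Lu memvZ ?memv_line.
by rewrite mulf_eq0 => /orP[] /eqP /w0; [left|right].
Qed.

(** On the line through v, the homogeneous components of p at v are the
coefficients of a polynomial in one variable that vanishes everywhere. *)
Lemma vanishes_pihomog p L e : vanishes p L -> vanishes (pihomog mdeg e p) L.
Proof.
move=> p0 v Lv; pose k := maxn (msize p) e.+1.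
pose q := \poly_(i < k) (pihomog mdeg i p).@[v ord0].
have q0 : q = 0.
  apply: poly_eq0_everywhere => a; rewrite horner_poly.
  rewrite -[RHS](p0 (a *: v)) ?memvZ //.
  rewrite {2}(pihomog_partitionE (leq_maxl _ _ : (msize p <= k)%N)).
  rewrite raddf_sum; apply: eq_bigr => i _ /=.
  by rewrite (meval_homogZ _ _ (pihomogP _ _ _)) mulrC.
by have := congr1 (coefp e) q0; rewrite /= coef_poly leq_maxr coef0.
Qed.

Lemma closed_vanishes p : closed [set L | vanishes p L].
Proof.
rewrite closed_zariskiE; exists (range (fun e => pihomog mdeg e p)).
  by move=> _ [e _ <-]; apply/homogP; exists e; apply: pihomogP.
apply/seteqP; split=> [L pL _ [e _ <-]|L pL v Lv].
  exact: vanishes_pihomog.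
rewrite (pihomog_partitionE (leqnn (msize p))) raddf_sum big1 // => i _.
by apply: pL => //; exists (i : nat).
Qed.

(** As [vanishes] tests all the vectors of a line, this is the ideal of the
affine cone over Z. *)
Definition vanishing_ideal Z : set {mpoly F[N.+1]} :=
  [set p | Z `<=` [set L | vanishes p L]].

Lemma prime_vanishing_ideal Z :
  irreducible_set Z -> prime_ideal (vanishing_ideal Z).
Proof.
case=> [[L0 ZL0] Zirr]; split.
- by move=> L _ v _; rewrite meval0.
- by move=> p q p0 q0 L ZL v Lv; rewrite mevalD (p0 L) // (q0 L) // addr0.
- by move=> a p p0 L ZL v Lv; rewrite mevalM (p0 L) // mulr0.
- by move=> /(_ L0 ZL0 0 (mem0v _)) /eqP; rewrite meval1 oner_eq0.
- move=> p q pq0; apply: Zirr; [exact: closed_vanishes|exact: closed_vanishes|].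
  by move=> L /pq0; apply: vanishesM.
Qed.

Lemma vanishing_ideal_proper Z1 Z2 :
  closed Z1 -> Z1 `<` Z2 -> vanishing_ideal Z2 `<` vanishing_ideal Z1.
Proof.
rewrite closed_zariskiE => -[S _ Z1E] [Z12 nZ21]; split.
  by move=> p p0 L /Z12; apply: p0.
move=> I12; apply: nZ21 => L Z2L; rewrite Z1E => p Sp.
by apply: I12 Z2L; rewrite Z1E => L'; apply.
Qed.

(** A chain of length k in Z gives k + 1 primes; with the ideal of the origin
and the zero ideal they form a chain of length k + 2 in N + 1 variables.  The
ideals of the cones are different from the first, since a line contains a
nonzero vector, and from the last, since they contain p. *)
Lemma krull_dim_in_hypersurface (R : realType) Z p :
  closed Z -> p != 0 -> vanishing_ideal Z p ->
  (krull_dim R Z <= (N%:R - 1)%:E)%E.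
Proof.
move=> Zclosed p_neq0 pZ; apply/ereal_supP => _ [k [W [Wirr Wclosed Wlt]] <-].
rewrite lee_fin lerBrDr -[1]/(1%:R) -natrD ler_nat addn1.
have Wcl i : (i <= k)%N -> closed (W i).
  by move=> /Wclosed[B Bcl ->]; apply: closedI.
have WZ : W k `<=` Z by have [B _ ->] := Wclosed k (leqnn k); apply: subIsetl.
pose I i :=
  if i is j.+1 then if (j <= k)%N then vanishing_ideal (W j) else [set 0]
  else [set q : {mpoly F[N.+1]} | q.@[fun=> 0] = 0].
have := @prime_chain_leq _ _ I k.+2; rewrite ltnS; apply.
  case=> [_|j _] /=.
    split=> /=.
    - by rewrite meval0.
    - by move=> x y x0 y0; rewrite mevalD x0 y0 addr0.
    - by move=> a x x0; rewrite mevalM x0 mulr0.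
    - by rewrite meval1 => /eqP; rewrite oner_eq0.
    - move=> x y; rewrite mevalM => /eqP.
      by rewrite mulf_eq0 => /orP[] /eqP; [left|right].
  case: leqP => [/Wirr|_]; first exact: prime_vanishing_ideal.
  split=> //=.
  - by move=> x y -> ->; rewrite addr0.
  - by move=> a x ->; rewrite mulr0.
  - by move=> /eqP; rewrite oner_eq0.
  - by move=> x y /eqP; rewrite mulf_eq0 => /orP[] /eqP; [left|right].
case=> [_|j]; rewrite /I.
  have [[L W0L] _] := Wirr 0%N isT; split => [q /(_ L W0L) q0|].
    rewrite /= -[RHS](q0 0 (mem0v _)); apply: meval_eq => i.
    by rewrite mxE.
  have [u /rV0Pn[i ui] Lu] := line_generator L.
  move=> /(_ 'X_i) /= /(_ _)/wrap[]; first by rewrite mevalXU.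
  move=> /(_ L W0L u); rewrite Lu memv_line mevalXU => /(_ isT)/eqP.
  by rewrite (negPf ui).
rewrite !ltnS => jk; rewrite jk; case: (ltnP j k) => [jk'|kj].
  by apply: vanishing_ideal_proper; [apply: Wcl|apply: Wlt].
have -> : j = k by apply/eqP; rewrite eqn_leq jk.
split=> [_ -> L _ v _|]; first by rewrite meval0.
by move=> /(_ p (subset_trans WZ pZ)) /eqP; rewrite (negPf p_neq0).
Qed.

End VanishingIdeals.

(** * Dimension of a Segre-Veronese variety *)

Section SegreVeroneseCoordinates.
Variables (F : fieldType) (r : nat) (n d : r.-tuple nat).
Local Notation N := (sv_dim n d).
Local Notation point := (forall i : 'I_r, 'rV[F]_(tnth n i).+1).
Implicit Types (x y : point) (L : proj F N).

Lemma segre_veroneseP L : segre_veronese F n d L <->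
  exists2 x : point, forall i, x i != 0 & line L = <[sv_vec d x]>%VS.
Proof.
split=> [[P _ <-]|[x x0 Lx]].
  exists (fun i => vpick (line (P i))) => // i.
  by rewrite vpick0 -dimv_eq0 (eqP (dim_line (P i))).
have xline i : \dim <[x i]> == 1%N by rewrite dim_vline x0.
exists (fun i => Proj (xline i)) => //; apply/val_inj => /=.
by rewrite Lx; apply: (@sv_mapE F r n d (fun i => Proj (xline i))).
Qed.

(** The coordinate of P^N whose monomial has the exponents e; the default
value is reached only when e does not have multidegree d. *)
Definition sv_monomial (e : 'I_r -> nat -> nat) : 'I_N.+1 :=
  odflt ord0 [pick j | [forall i, forall k : 'I_(tnth n i).+1,
    tnth (val (sv_coord (n := n) (d := d) j i)) k == e i k :> nat]].

Lemma sv_monomialE (e : 'I_r -> nat -> nat) :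
  (forall i, \sum_(k < (tnth n i).+1) e i k = tnth d i)%N ->
  forall i k, tnth (val (sv_coord (sv_monomial e) i)) k = e i k :> nat.
Proof.
move=> esum; rewrite /sv_monomial; case: pickP => [j /forallP ej i k|/= none].
  by have /forallP/(_ k)/eqP := ej i.
pose t i : (tnth n i).+1.-tuple 'I_(tnth d i).+1 :=
  [tuple inord (e i k) | k < (tnth n i).+1].
have tE i k : tnth (t i) k = e i k :> nat.
  by rewrite tnth_mktuple inordK // ltnS -esum (bigD1 k) //= leq_addr.
have tsum i : (\sum_(k <- t i) k == tnth d i)%N.
  by rewrite big_tuple; under eq_bigr do rewrite tE; rewrite esum.
pose m : sv_index n d := [ffun i => Sub (t i) (tsum i)].
have /negP[] := negbT (none (cast_ord (card_sv_index n d) (enum_rank m))).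
apply/forallP => i; apply/forallP => k.
by rewrite /sv_coord cast_ordK enum_rankK ffunE tE.
Qed.

Lemma sv_vec_monomial x (e : 'I_r -> nat -> nat) :
  (forall i, \sum_(k < (tnth n i).+1) e i k = tnth d i)%N ->
  sv_vec d x ord0 (sv_monomial e) =
    \prod_(i < r) \prod_(k < (tnth n i).+1) x i ord0 k ^+ e i k.
Proof.
move=> esum; rewrite mxE; apply: eq_bigr => i _; apply: eq_bigr => k _.
by rewrite sv_monomialE.
Qed.

End SegreVeroneseCoordinates.

Section SegreVeroneseDimension.
Variables (F : numFieldType) (r : nat) (n d : r.-tuple nat).
Local Notation N := (sv_dim n d).
Local Notation point := (forall i : 'I_r, 'rV[F]_(tnth n i).+1).
Implicit Types (x y : point) (L : proj F N).

Definition sv_linear (V : forall i : 'I_r, set 'rV[F]_(tnth n i).+1) :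
    set (proj F N) :=
  [set L | exists2 x : point, forall i, V i (x i) /\ x i != 0 &
             line L = <[sv_vec d x]>%VS].

(** If p does not vanish at the image of x, nor q at the image of y, join x to
y by the segment z t = (1 - t) x + t y.  Then p and q, evaluated at the image
of z t, and one coordinate of each factor of z t are nonzero polynomials in t,
so that for some t none of them vanishes: the image of z t is a point where
neither p nor q vanishes. *)
Lemma irreducible_sv_linear (V : forall i : 'I_r, set 'rV[F]_(tnth n i).+1) :
  (forall i a b (u v : 'rV[F]_(tnth n i).+1),
     V i u -> V i v -> V i (a *: u + b *: v)) ->
  (forall i, exists2 u, V i u & u != 0) -> irreducible_set (sv_linear V).
Proof.
move=> Vlin Vn0; split.
  have /fin_all_exists[x xP] i : exists u, V i u /\ u != 0.
    by have [u] := Vn0 i; exists u.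
  have xline : \dim <[sv_vec d x]> == 1%N.
    by rewrite dim_vline sv_vec_neq0 // => i; case: (xP i).
  by exists (Proj xline); exists x.
move=> B C; rewrite !closed_zariskiE => -[S _ ->] [T _ ->] VBC.
apply: contrapT => /not_orP[] /existsNP[L /not_implyP[[x xP Lx]]].
move=> /existsNP[p /not_implyP[Sp nSp]] /existsNP[M /not_implyP[[y yP My]]].
move=> /existsNP[q /not_implyP[Tq nTq]].
have [u [Lu pu0]] : exists u, u \in line L /\ p.@[u ord0] != 0.
  by move/existsNP: nSp => [u /not_implyP[Lu /eqP]]; exists u.
have [v [Mv qv0]] : exists v, v \in line M /\ q.@[v ord0] != 0.
  by move/existsNP: nTq => [v /not_implyP[Mv /eqP]]; exists v.
have {Lu} [a ua] : exists a, u = a *: sv_vec d x by apply/vlineP; rewrite -Lx.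
have {Mv} [b vb] : exists b, v = b *: sv_vec d y by apply/vlineP; rewrite -My.
have /fin_all_exists[k0 xk0] i : exists k, x i ord0 k != 0.
  by apply/rV0Pn; case: (xP i).
pose z t : point := fun i => (1 - t) *: x i + t *: y i.
pose w i k : {poly F} := (1 - 'X) * (x i ord0 k)%:P + 'X * (y i ord0 k)%:P.
have wE i k t : (w i k).[t] = z t i ord0 k by rewrite !hornerE !mxE.
pose W (j : 'I_N.+1) : {poly F} := \prod_(i < r) \prod_(k < (tnth n i).+1)
  w i k ^+ tnth (val (sv_coord j i)) k.
have WE j t : (W j).[t] = sv_vec d (z t) ord0 j.
  rewrite mxE horner_prod; apply: eq_bigr => i _.
  by rewrite horner_prod; apply: eq_bigr => k _; rewrite horner_exp wE.
pose P := mmap polyC (fun j => a%:P * W j) p.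
pose Q := mmap polyC (fun j => b%:P * W j) q.
have PE t : P.[t] = p.@[(a *: sv_vec d (z t)) ord0].
  rewrite horner_mmap; apply: meval_eq => j.
  by rewrite hornerM hornerC WE [in RHS]mxE.
have QE t : Q.[t] = q.@[(b *: sv_vec d (z t)) ord0].
  rewrite horner_mmap; apply: meval_eq => j.
  by rewrite hornerM hornerC WE [in RHS]mxE.
have z0 : z 0 = x.
  apply: functional_extensionality_dep => i.
  by rewrite /z subr0 scale1r scale0r addr0.
have z1 : z 1 = y.
  apply: functional_extensionality_dep => i.
  by rewrite /z subrr scale1r scale0r add0r.
(* the value of each factor is known at one end of the segment *)
have PQw0 : P * Q * \prod_i w i (k0 i) != 0.
  rewrite !mulf_neq0 //; last (apply/prodf_neq0 => i _); apply/eqP.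
  - move/(congr1 (horner^~ 0)); rewrite PE z0 -ua horner0 => /eqP.
    by rewrite (negPf pu0).
  - move/(congr1 (horner^~ 1)); rewrite QE z1 -vb horner0 => /eqP.
    by rewrite (negPf qv0).
  - move/(congr1 (horner^~ 0)); rewrite wE z0 horner0 => /eqP.
    by rewrite (negPf (xk0 i)).
have [t] : exists t, (P * Q * \prod_i w i (k0 i)).[t] != 0.
  apply: contrapT => /forallNP PQw; move/eqP: PQw0; apply.
  apply: poly_eq0_everywhere => t.
  by apply/eqP; apply: contrapT => /negP; apply: PQw.
rewrite !hornerM !mulf_eq0 !negb_or PE QE horner_prod.
move=> /andP[/andP[Pt Qt] /prodf_neq0 wt].
have zt_neq0 i : z t i != 0.
  by apply/rV0Pn; exists (k0 i); rewrite -wE; apply: wt.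
have ztline : \dim <[sv_vec d (z t)]> == 1%N by rewrite dim_vline sv_vec_neq0.
have /VBC [] : sv_linear V (Proj ztline).
- by exists (z t) => // i; split=> //; apply: Vlin; [case: (xP i)|case: (yP i)].
- move/(_ p Sp (a *: sv_vec d (z t))) /(_ (memvZ _ (memv_line _))) /eqP.
  by rewrite (negPf Pt).
- move/(_ q Tq (b *: sv_vec d (z t))) /(_ (memvZ _ (memv_line _))) /eqP.
  by rewrite (negPf Qt).
Qed.

(** S selects, in each factor, the homogeneous coordinates set to zero. *)
Definition sv_coord_sub (S : forall i : 'I_r, pred 'I_(tnth n i).+1) :
    set (proj F N) :=
  sv_linear (fun i => [set u | forall l, S i l -> u ord0 l = 0]).

Definition sv_coord_eqs (S : forall i : 'I_r, pred 'I_(tnth n i).+1) :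
    set (proj F N) :=
  \bigcap_(j in [set j : 'I_N.+1 | exists i l, S i l /\
                    (0 < tnth (val (sv_coord (n := n) (d := d) j i)) l)%N])
    [set L | vanishes 'X_j L].

Hypothesis d_gt0 : forall i, (0 < tnth d i)%N.

(** Suppose that the coordinate x_(i, l) selected by S is nonzero.  Choose a
nonzero coordinate in every factor, the one of the factor i being x_(i, l).
The product of their d_i-th powers is a coordinate of the image of x that is
nonzero and that the equations of [sv_coord_eqs] set to zero. *)
Lemma sv_coord_eqsP S L x :
  (forall i, x i != 0) -> line L = <[sv_vec d x]>%VS ->
  sv_coord_eqs S L <-> forall i l, S i l -> x i ord0 l = 0.
Proof.
move=> x0 Lx; split=> [LS i l Sil|xS j [i [l [Sil jl]]] v].
  apply/eqP; apply: contraT => xil.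
  have /fin_all_exists[k0 xk0] i' : exists k, x i' ord0 k != 0 by apply/rV0Pn.
  pose k i' : nat := if i' == i then l : nat else k0 i' : nat.
  pose e i' m := ((m == k i') * tnth d i')%N.
  have kn i' : (k i' < (tnth n i').+1)%N by rewrite /k; case: eqP => [->|].
  have esum i' : (\sum_(m < (tnth n i').+1) e i' m = tnth d i')%N.
    rewrite (bigD1 (Ordinal (kn i'))) //= /e eqxx mul1n big1 ?addn0 // => m.
    by rewrite -val_eqE /= => /negPf->.
  have := LS (sv_monomial n d e) _ (sv_vec d x).
  rewrite Lx memv_line mevalXU /=.
  rewrite sv_vec_monomial // => /(_ _ isT)/wrap[].
    exists i, l; split=> //; rewrite sv_monomialE // /e /k eqxx eqxx mul1n.
    exact: d_gt0.
  move/eqP; apply: contraTT => _.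
  apply/prodf_neq0 => i' _; apply/prodf_neq0 => m _.
  rewrite /e; have [mk|_] := eqVneq (m : nat) (k i'); last first.
    by rewrite mul0n expr0 oner_eq0.
  rewrite expf_neq0 //; move: mk; rewrite /k.
  case: eqP => [i'i|_] mk; last first.
    by have -> : m = k0 i' by apply/val_inj.
  by move: m mk; rewrite i'i => m mk; have -> : m = l by apply/val_inj.
rewrite Lx => /vlineP[a ->]; rewrite mevalXU mxE; apply/eqP; rewrite mulf_eq0.
apply/orP; right; rewrite mxE (bigD1 i) //= (bigD1 l) //= xS //.
by rewrite expr0n eqn0Ngt jl !mul0r.
Qed.

Lemma sv_coord_subE S :
  sv_coord_sub S = segre_veronese F n d `&` sv_coord_eqs S.
Proof.
apply/seteqP; split=> [L [x xS Lx]|L [/segre_veroneseP[x x0 Lx] LS]].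
  have x0 i : x i != 0 by case: (xS i).
  split; first by apply/segre_veroneseP; exists x.
  by apply/(sv_coord_eqsP S x0 Lx) => i; case: (xS i).
by exists x => // i; split=> //; apply: (sv_coord_eqsP S x0 Lx).1 LS i.
Qed.

Lemma closed_sv_coord_eqs S : closed (sv_coord_eqs S).
Proof. by apply: closed_bigI => j _; apply: closed_vanishes. Qed.

(** The members of T are the coordinates other than the first one of each
factor.  The t-th set of the chain is cut out by the vanishing of all of them
except the first t, in the order of the enumeration of T; releasing the next
one, x_(i0, k0 + 1), adds the image of the point whose i0-th factor is the
corresponding vector of the standard basis. *)
Lemma krull_dim_segre_veronese_ge (R : realType) :
  (((\sum_i tnth n i)%N)%:R%:E <= krull_dim R (segre_veronese F n d))%E.
Proof.
pose T : finType := {i : 'I_r & 'I_(tnth n i)}.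
have -> : (\sum_i tnth n i = #|T|)%N.
  rewrite card_tagged sumnE big_map big_enum; apply: eq_bigr => i _.
  by rewrite card_ord.
pose S t i (l : 'I_(tnth n i).+1) :=
  if unlift ord0 l is Some k
  then (t <= enum_rank (Tagged (fun i => 'I_(tnth n i)) k : T))%N else false.
apply: ereal_sup_ubound; exists #|T| => //.
exists (fun t => sv_coord_sub (S t)); split.
- move=> t _; apply: irreducible_sv_linear => i => [a b u v uS vS l Sl|].
    by rewrite !mxE uS // vS // !mulr0 addr0.
  exists (delta_mx ord0 ord0) => [l|].
    by rewrite mxE /S eqxx; case: unliftP => [k ->|-> //].
  by apply/rV0Pn; exists ord0; rewrite mxE !eqxx oner_eq0.
- move=> t _; exists (sv_coord_eqs (S t)); first exact: closed_sv_coord_eqs.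
  exact: sv_coord_subE.
move=> t tT; split.
  move=> L [x xS Lx]; exists x => // i; have [xi x0] := xS i; split=> // l.
  rewrite /S => Sl; apply: xi; move: Sl.
  by rewrite /S; case: unliftP => // k _ /ltnW.
have [i0 [k0 rank0]] : exists i0 (k0 : 'I_(tnth n i0)),
    enum_rank (Tagged (fun i => 'I_(tnth n i)) k0 : T) = t :> nat.
  case E: (enum_val (Ordinal tT)) => [i k]; exists i, k.
  by have := enum_valK (Ordinal tT); rewrite E => ->.
pose l0 (i : 'I_r) := if i == i0 then k0.+1 else 0%N.
have l0n i : (l0 i < (tnth n i).+1)%N.
  by rewrite /l0; case: (i =P i0) => [->|//]; rewrite ltnS; exact: ltn_ord.
pose x : point := fun i => delta_mx ord0 (Ordinal (l0n i)).
have x0 i : x i != 0.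
  by apply/rV0Pn; exists (Ordinal (l0n i)); rewrite mxE !eqxx oner_eq0.
have xline : \dim <[sv_vec d x]> == 1%N by rewrite dim_vline sv_vec_neq0.
have xS : sv_coord_sub (S t.+1) (Proj xline).
  exists x => // i; split=> // l; rewrite /S; case: unliftP => // k -> tk.
  rewrite mxE eqxx /=; apply/eqP; rewrite pnatr_eq0 eqb0; apply: contraTN tk.
  rewrite -val_eqE /= /bump /l0; case: (i =P i0) k => // -> k.
  by rewrite add1n eqSS => /eqP/val_inj ->; rewrite rank0 ltnn.
move=> /(_ _ xS); rewrite sv_coord_subE => -[_].
move=> /(sv_coord_eqsP (S t) x0 (erefl : line (Proj xline) = _)).
move=> /(_ i0 (lift ord0 k0)).
rewrite /S liftK rank0 leqnn => /(_ isT) /eqP.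
by rewrite mxE eqxx /= -val_eqE /= /bump /l0 eqxx add1n eqxx oner_eq0.
Qed.

End SegreVeroneseDimension.

(** * The flattening and its determinant *)

(** A point of the span of h points of X is a sum of h vectors at which the
matrix of coordinates has rank at most 1. *)
Lemma vanishing_secant_det (F : numFieldType) (N m h : nat) (X : set (proj F N))
    (J : 'I_m -> 'I_m -> 'I_N.+1) :
  (forall L v, X L -> v \in line L ->
     (\rank (\matrix_(i, j) v ord0 (J i j)) <= 1)%N) ->
  (h < m)%N ->
  vanishing_ideal (secant_variety h X) (\det (\matrix_(i, j) 'X_(J i j))).
Proof.
move=> rank1 hm L; rewrite /secant_variety closureEbigcap; apply; split.
  exact: closed_vanishes.
move=> {}L [P XP LP] v Lv.
rewrite -det_map_mx.
rewrite (_ : map_mx _ _ = \matrix_(i, j) v ord0 (J i j)); last first.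
  by apply/matrixP => i j; rewrite !mxE /= mevalXU.
have /memv_sumP[w wP ->] : v \in (\sum_i line (P i))%VS by apply: subvP LP _ Lv.
apply/eqP; apply: contraTT hm => det_neq0; rewrite -leqNgt.
set M := \matrix_(i, j) _ in det_neq0.
have <- : \rank M = m by apply: mxrank_unit; rewrite unitmxE unitfE.
have -> : M = \sum_k \matrix_(i, j) w k ord0 (J i j).
  apply/matrixP => i j; rewrite mxE !summxE.
  by apply: eq_bigr => k _; rewrite mxE.
apply: leq_trans (_ : (\sum_(k < h) 1 <= h)%N); last first.
  by rewrite sum1_card card_ord.
elim/big_rec2: _ => [|k A s _ rankA]; first by rewrite mxrank0.
by apply: leq_trans (mxrank_add _ _) _; rewrite leq_add // (rank1 (P k)) ?wP.
Qed.

Section Flattening.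
Variables (F : fieldType) (r : nat) (n d : r.-tuple nat).

(** A monomial with exponents alpha p + beta q is a product of a factor that
depends only on p and a factor that depends only on q. *)
Lemma rank_flattening (x : forall i : 'I_r, 'rV[F]_(tnth n i).+1) m1 m2
    (alpha : 'I_m1 -> 'I_r -> nat -> nat) (beta : 'I_m2 -> 'I_r -> nat -> nat) :
  (forall p q i,
     \sum_(k < (tnth n i).+1) (alpha p i k + beta q i k) = tnth d i)%N ->
  (\rank (\matrix_(p, q) sv_vec d x ord0
       (sv_monomial n d (fun i k => alpha p i k + beta q i k)%N)) <= 1)%N.
Proof.
move=> ab_d.
pose mon (e : 'I_r -> nat -> nat) :=
  \prod_i \prod_(k < (tnth n i).+1) x i ord0 k ^+ e i k.
rewrite (_ : \matrix_(_, _) _ =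
  (\col_p mon (alpha p)) *m (\row_q mon (beta q))).
  by apply: leq_trans (mxrankM_maxl _ _) _; apply: rank_leq_col.
apply/matrixP => p q; rewrite mxE sv_vec_monomial // mxE big_ord1 !mxE.
rewrite -big_split; apply: eq_bigr => i _.
by rewrite -big_split; apply: eq_bigr => k _; apply: exprD.
Qed.

End Flattening.

Section HankelFlattening.
Variables (F : fieldType) (n d1 d2 : nat).
Hypothesis square : (2 * d1.+1 = d2.+1 * n.+1)%N.

Local Notation ns := [tuple 1; 1; n]%N.
Local Notation ds := [tuple 1; d1 + d2; 1]%N.
Local Notation m := (2 * d1.+1)%N.

(** The row p = a (d1 + 1) + i stands for the monomial x_a y_0^(d1-i) y_1^i;
the column q = c (d2 + 1) + (d2 - j) stands for y_0^(d2-j) y_1^j w_c.  The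
reversed order of the j makes the flattening the identity at the point used in
[hankel_det_neq0]. *)
Definition hankel_row (p : 'I_m) (i : 'I_3) (k : nat) : nat :=
  (nth 0 [:: nat_of_bool (k == p %/ d1.+1);
             if k == 0 then d1 - p %% d1.+1 else p %% d1.+1; 0] i)%N.

Definition hankel_col (q : 'I_m) (i : 'I_3) (k : nat) : nat :=
  (nth 0 [:: 0; if k == 0 then q %% d2.+1 else d2 - q %% d2.+1;
             nat_of_bool (k == q %/ d2.+1)] i)%N.

Definition hankel_index (p q : 'I_m) : 'I_(sv_dim ns ds).+1 :=
  sv_monomial ns ds (fun i k => hankel_row p i k + hankel_col q i k)%N.

Lemma sum_nat_eq_ord b c (f : nat -> nat) : (c < b)%N ->
  (\sum_(k < b) f k * (k == c :> nat) = f c)%N.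
Proof.
move=> cb; rewrite (bigD1 (Ordinal cb)) //= eqxx muln1 big1 ?addn0 // => k.
by rewrite -val_eqE /= => /negPf ->; rewrite muln0.
Qed.

Lemma hankel_row_lt (p : 'I_m) : (p %/ d1.+1 < 2)%N.
Proof. by rewrite ltn_divLR. Qed.

Lemma hankel_col_lt (q : 'I_m) : (q %/ d2.+1 < n.+1)%N.
Proof. by rewrite ltn_divLR // (leq_trans (ltn_ord q)) // square mulnC. Qed.

Lemma hankel_degree p q i :
  (\sum_(k < (tnth ns i).+1) (hankel_row p i k + hankel_col q i k)
     = tnth ds i)%N.
Proof.
have p2 := hankel_row_lt p.
have qn := hankel_col_lt q.
have pd : (p %% d1.+1 <= d1)%N by rewrite -ltnS ltn_mod.
have qd : (q %% d2.+1 <= d2)%N by rewrite -ltnS ltn_mod.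
rewrite !(tnth_nth 0%N); case: i => [[|[|[|//]]] i3] /=.
- apply: etrans (sum_nat_eq_ord (fun=> 1%N) p2); apply: eq_bigr => k _.
  by rewrite mul1n; apply: addn0.
- rewrite !big_ord_recl big_ord0 /hankel_row /hankel_col /=; lia.
- apply: etrans (sum_nat_eq_ord (fun=> 1%N) qn); apply: eq_bigr => k _.
  by rewrite mul1n; apply: add0n.
Qed.

(** On the coordinate z_(a, k, c) the three weights are a, k and c. *)
Definition sv_weight (j : 'I_(sv_dim ns ds).+1) (i : 'I_3) : nat :=
  (\sum_(k < (tnth ns i).+1) k * tnth (val (sv_coord j i)) k)%N.

Lemma sv_weight_hankel p q :
  [/\ sv_weight (hankel_index p q) 0%R = p %/ d1.+1,
      sv_weight (hankel_index p q) 1%R = p %% d1.+1 + (d2 - q %% d2.+1) &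
      sv_weight (hankel_index p q) 2%R = q %/ d2.+1 ]%N.
Proof.
have p2 := hankel_row_lt p.
have qn := hankel_col_lt q.
have wE i : sv_weight (hankel_index p q) i =
    (\sum_(k < (tnth ns i).+1) k * (hankel_row p i k + hankel_col q i k))%N.
  by apply: eq_bigr => k _; rewrite sv_monomialE //; apply: hankel_degree.
split; rewrite wE.
- under eq_bigr do rewrite addn0.
  exact: (sum_nat_eq_ord id p2).
- rewrite !big_ord_recl big_ord0 /hankel_row /hankel_col /=.
  by rewrite mul0n mul1n addn0.
- under eq_bigr do rewrite add0n.
  exact: (sum_nat_eq_ord id qn).
Qed.

(** At z_(a, k, c) = [a (d1 + 1) + k = c (d2 + 1) + d2], the entry in row
a (d1 + 1) + i and column c (d2 + 1) + (d2 - j) is the truth value of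
a (d1 + 1) + i + j = c (d2 + 1) + d2, that is, of the equality of the row and
the column. *)
Lemma hankel_det_neq0 : \det (\matrix_(p, q) 'X_(hankel_index p q)) != 0
  :> {mpoly F[(sv_dim ns ds).+1]}.
Proof.
pose v (j : 'I_(sv_dim ns ds).+1) : F :=
  (sv_weight j 0%R * d1.+1 + sv_weight j 1%R
     == sv_weight j 2%R * d2.+1 + d2)%N%:R.
apply/eqP => /(congr1 (meval v)).
rewrite raddf0 -det_map_mx (_ : map_mx _ _ = 1%:M) ?det1 //.
  by move/eqP; rewrite oner_eq0.
apply/matrixP => p q; rewrite !mxE /= mevalXU /v.
have [-> -> ->] := sv_weight_hankel p q; congr (_%:R); congr nat_of_bool.
have qd : (q %% d2.+1 <= d2)%N by rewrite -ltnS ltn_mod.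
rewrite addnA -divn_eq -val_eqE /= [in RHS](divn_eq q d2.+1).
by apply/eqP/eqP; lia.
Qed.

End HankelFlattening.

Lemma sv_dim_11n n d :
  (sv_dim [tuple 1; 1; n]%N [tuple 1; d; 1]%N).+1 = (2 * d.+1 * n.+1)%N.
Proof.
rewrite /sv_dim !big_ord_recl big_ord0 !(tnth_nth 0%N) /= !addSn add0n muln1.
by rewrite addn1 !bin1 binSn prednK ?muln_gt0 // mulnA.
Qed.

Unset Implicit Arguments.
Local Open Scope nat_scope.

Theorem proposition6p4 (R : realType) (n d d1 d2 : nat) :
  2 <= n -> 2 <= d -> 1 <= d1 -> 1 <= d2 -> d = d1 + d2 ->
  2 * (d1 + 1) = (d2 + 1) * (n + 1) ->
  defective R (segre_veronese R[i] [tuple 1; 1; n] [tuple 1; d; 1])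
    (2 * d1 + 1).
Proof.
move=> n2 d_ge2 _ _ dE sq; subst d.
have square : (2 * d1.+1 = d2.+1 * n.+1)%N by rewrite !addn1 in sq.
set N := sv_dim [tuple 1; 1; n]%N [tuple 1; d1 + d2; 1]%N.
set X := segre_veronese _ _ _; set h := (2 * d1 + 1)%N.
have NE : N.+1 = (2 * (d1 + d2).+1 * n.+1)%N by exact: sv_dim_11n.
have dimX : ((n + 2)%:R%:E <= krull_dim R X)%E.
  have sum_dims : (\sum_(i < 3) tnth [tuple 1; 1; n] i = n + 2)%N.
    by rewrite !big_ord_recl big_ord0 !(tnth_nth 0%N) /=; lia.
  rewrite -sum_dims; apply: krull_dim_segre_veronese_ge => i.
  by rewrite (tnth_nth 0%N); case: i => [[|[|[|//]]] ?] //=; lia.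
have dimSec : (krull_dim R (secant_variety h X) <= (N%:R - 1)%R%:E)%E.
  apply: (@krull_dim_in_hypersurface R[i] N R _ _ _ (hankel_det_neq0 _ square)).
    exact: closed_closure.
  apply: vanishing_secant_det; last by rewrite /h; lia.
  move=> L v /segre_veroneseP[x _ ->] /vlineP[a ->].
  rewrite (_ : \matrix_(i, j) _ = (a *: \matrix_(i, j)
      sv_vec _ x ord0 (hankel_index n d2 i j))%R); last first.
    by apply/matrixP => i j; rewrite !mxE.
  apply: leq_trans (mxrankS (scalemx_sub a (submx_refl _))) _.
  exact/rank_flattening/hankel_degree.
apply: le_lt_trans dimSec _.
apply: (@lt_le_trans _ _ N%:R%:E); first by rewrite lte_fin ltrBlDr ltrDl.
rewrite /expected_dim le_min lexx andbT.
apply: le_trans (leeD2r _ (lee_wpmul2r _ dimX)); last by rewrite lee_fin.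
rewrite -EFinM -EFinD lee_fin addrA lerBrDr -natrM -natrD natr1 ler_nat.
(* with D = d2 + 1, this reads D (n + 1) (n + 3) - (n + 3) >=
   (D (n + 3) - 2) (n + 1), that is, n >= 1 *)
nia.
Qed.
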